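(* There exist constants $0<\alpha,\beta<1$ such that for any $n\in\mathbb{N}$ (with $m=n/\beta$) there exists an $n\times m$ matrix over $\mathbb{F}_2$ which is the generating matrix of an asymptotically good code, and such that any sub-matrix formed by taking any $\alpha n$ columns and the last $n/2$ rows has full column rank. In addition, for some $\varepsilon=2^{-O(n)}$, an $\varepsilon$-biased sample space over $nm$ bits generates (when its output is read as an $n\times m$ matrix) such a matrix with probability $1-2^{-\Omega(n)}$.
   Context: A generating matrix of an asymptotically good code here means a matrix over $\mathbb{F}_2$ whose rows are linearly independent and such that every nonzero linear combination of the rows has Hamming weight at least $\delta m$ for a fixed absolute constant $\delta>0$. An $\varepsilon$-biased sample space over $N$ bits is a distribution on $\{0,1\}^N$ under which the parity of every nonempty subset of coordinates equals $1$ with probability within $\varepsilon$ of $1/2$. *)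

(* Defs.v *)
From mathcomp Require Export all_boot all_order all_algebra.
From mathcomp Require Export reals exp.
Set Implicit Arguments.
Unset Strict Implicit.
Unset Printing Implicit Defensive.
Import Order.TTheory GRing.Theory Num.Theory.
Local Open Scope ring_scope.

Definition hamming_weight (m : nat) (v : 'rV['F_2]_m) : nat :=
  #|[set j | v 0 j != 0]|.

Definition good_code_gen (R : realType) (delta : R) (n m : nat) (A : 'M['F_2]_(n, m)) : bool :=
  row_free A &&
  [forall u : 'rV['F_2]_n, (u *m A != 0) ==>
     (delta * m%:R <= (hamming_weight (u *m A))%:R)].

Definition submatrix (n m : nat) (I : {set 'I_n}) (J : {set 'I_m})
    (A : 'M['F_2]_(n, m)) : 'M['F_2]_(#|I|, #|J|) :=
  mxsub (@enum_val _ (mem I)) (@enum_val _ (mem J)) A.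

(* When n is odd, n / 2 is rounded down. *)
Definition last_half_rows (n : nat) : {set 'I_n} :=
  [set i : 'I_n | (n - n./2 <= i)%N].

(* The number alpha * n of columns is rounded down. *)
Definition last_half_full_col_rank (R : realType) (alpha : R) (n m : nat)
    (A : 'M['F_2]_(n, m)) : bool :=
  [forall J : {set 'I_m}, (#|J| == Num.truncn (alpha * n%:R)) ==>
     (\rank (submatrix (last_half_rows n) J A) == #|J|)].

Definition desired_matrix (R : realType) (alpha delta : R) (n m : nat)
    (A : 'M['F_2]_(n, m)) : bool :=
  good_code_gen delta A && last_half_full_col_rank alpha A.

Definition is_distribution (R : realType) (T : finType) (P : T -> R) : Prop :=
  (forall x, 0 <= P x) /\ \sum_x P x = 1.

Definition Pr (R : realType) (T : finType) (P : T -> R) (E : {set T}) : R :=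
  \sum_(x in E) P x.

Definition biased_sample_space (R : realType) (eps : R) (N : nat)
    (P : 'rV['F_2]_N -> R) : Prop :=
  is_distribution P /\
  forall S : {set 'I_N}, S != set0 ->
    `|Pr P [set x : 'rV['F_2]_N | \sum_(i in S) x 0 i == 1] - 2^-1| <= eps.

Definition O_linear (R : realType) (f : nat -> R) : Prop :=
  exists C : R, forall n : nat, 0 <= f n <= C * n%:R.

Definition Omega_linear (R : realType) (g : nat -> R) : Prop :=
  exists2 c : R, 0 < c & forall n : nat, c * n%:R <= g n.

(* Main.v *)
Require Import Defs.
From mathcomp Require Import ring lra zify.
Import Order.TTheory GRing.Theory Num.Theory.
Local Open Scope ring_scope.

(**
Take beta = delta = 1/16, alpha = 1/64, eps = 2^-m with m = 16 n.  By Fourier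
inversion on F_2^k, an eps-biased vector x satisfies Pr[L x = v] <= 2^-k + 2 eps
for every linear L onto F_2^k.  A matrix A fails to be as desired only if
- u A has weight at most n for some u <> 0: for fixed u and v the event u A = v
  has probability at most 3 2^-m; or
- B w = 0 for some w <> 0 of weight at most alpha n, where B consists of the last
  n/2 rows of A: for fixed w this has probability at most 3 2^-(n/2).
A union bound concludes, since there are at most (1 + t)^m / t^a vectors of weight
at most a, for every 0 < t <= 1 (take t = 1/4, respectively t = 1/256).
The uniform distribution is eps-biased, which gives existence.
*)

(** * Characters of F_2^k and Fourier bounds for biased sample spaces *)

Lemma F2_cases (a : 'F_2) : a = 0 \/ a = 1.
Proof. by case: a => [[|[|]] // lt_a]; [left | right]; apply/val_inj. Qed.

Lemma F2_neq0 {a : 'F_2} : a != 0 -> a = 1.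
Proof. by case: (F2_cases a) => ->. Qed.

Lemma matrix_neq0P {m n : nat} {A : 'M['F_2]_(m, n)} :
  A != 0 -> exists i j, A i j = 1.
Proof.
move=> A_neq0.
have /existsP[i /existsP[j /F2_neq0 Aij]] : [exists i, exists j, A i j != 0].
  apply: contraNT A_neq0; rewrite negb_exists => /forallP A0.
  apply/eqP/matrixP=> i j; have := A0 i.
  by rewrite negb_exists => /forallP/(_ j)/negPn/eqP; rewrite mxE.
by exists i, j.
Qed.

(** The nontrivial additive character of F_2, with values 1 and -1. *)
Definition chi {R : realType} (a : 'F_2) : R := (-1) ^+ (a != 0).

Lemma chiD {R : realType} (a b : 'F_2) : chi (a + b) = chi a * chi b :> R.
Proof.
rewrite /chi; case: (F2_cases a) (F2_cases b) => -> [] ->;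
  by rewrite ?addr0 ?add0r /= ?expr0 ?expr1 ?mulr1 ?mul1r ?mulrNN ?mulr1.
Qed.

Lemma norm_chi {R : realType} (a : 'F_2) : `|chi a| = 1 :> R.
Proof. by rewrite /chi normrX normrN1 expr1n. Qed.

Lemma sum_chi {R : realType} {k : nat} (y : 'rV['F_2]_k) :
  \sum_(c : 'cV['F_2]_k) chi ((y *m c) 0 0) = (y == 0)%:R * 2 ^+ k :> R.
Proof.
have [->|/matrix_neq0P[i [j yj]]] := eqVneq y 0.
  under eq_bigr do rewrite mul0mx mxE /chi eqxx expr0.
  by rewrite sumr_const card_mx card_Fp // muln1 mul1r natrX.
rewrite mul0r; set S := LHS.
(* Translating [c] by the basis vector at a coordinate where [y] is 1 flips the sign of every
   term. *)
suff : S = - S by lra.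
rewrite {1}/S (reindex_inj (addrI (delta_mx j 0))) -sumrN /=.
apply: eq_bigr => c _; rewrite mulmxDr mxE -colE chiD mxE -(ord1 i) yj.
by rewrite /chi /= expr1 mulN1r.
Qed.

(** An additive [phi] is the parity over the set [S] of basis vectors it sends to 1, and [S] is
    nonempty because [phi] is nonzero. If that parity is 1 with probability [p], the character has
    mean 1 - 2p. *)
Lemma biased_character {R : realType} {N : nat} {eps : R}
    {P : 'rV['F_2]_N -> R} (phi : 'rV['F_2]_N -> 'F_2) :
  biased_sample_space eps P ->
  {morph phi : x y / x + y} -> (exists x, phi x != 0) ->
  `|\sum_x P x * chi (phi x)| <= 2 * eps.
Proof.
move=> biasP phiD [x0 phix0].
have phi0 : phi 0 = 0 by apply: (addrI (phi 0)); rewrite -phiD !addr0.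
pose S := [set i | phi (delta_mx 0 i) != 0].
have phiE x : phi x = \sum_(i in S) x 0 i.
  rewrite [in LHS](row_sum_delta x) (big_morph phi phiD phi0) [RHS]big_mkcond.
  apply: eq_bigr => i _; rewrite inE.
  case: (F2_cases (x 0 i)) => ->; first by rewrite scale0r phi0 if_same.
  by rewrite scale1r; case: ifPn => [/F2_neq0 | /negPn/eqP].
have S_neq0 : S != set0.
  by apply: contraNneq phix0 => S0; rewrite phiE S0 big_set0.
have [[P_ge0 P1] /(_ S S_neq0)] := biasP; set p := Pr P _ => ple.
suff -> : \sum_x P x * chi (phi x) = 2 * (2^-1 - p).
  by rewrite normrM distrC ger0_norm // ler_wpM2l.
have -> : 2 * (2^-1 - p) = 1 - 2 * p by field.
rewrite -[X in X - _]P1 /p /Pr mulr_sumr [in RHS]big_mkcond.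
rewrite [X in _ - X]big_mkcond -sumrB; apply: eq_bigr => x _.
rewrite inE -phiE /chi; case: (F2_cases (phi x)) => -> /=.
  by rewrite expr0 mulr1 subr0.
by rewrite expr1; ring.
Qed.

(** The last hypothesis says that [L] is onto, in dual form: no nonzero functional [c] vanishes on
    its image. In the inversion formula, [c = 0] contributes the main term 1, and each other [c] at
    most [2 * eps]. *)
Lemma biased_point {R : realType} {N : nat} {eps : R}
    {P : 'rV['F_2]_N -> R} {k : nat} (L : 'rV['F_2]_N -> 'rV['F_2]_k)
    (v : 'rV['F_2]_k) :
  0 <= eps -> biased_sample_space eps P -> {morph L : x y / x + y} ->
  (forall c : 'cV_k, c != 0 -> exists x, (L x *m c) 0 0 != 0) ->
  Pr P [set x | L x == v] <= 2 ^- k + 2 * eps.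
Proof.
move=> eps_ge0 biasP LD Lnd.
have [[P_ge0 P1] _] := biasP.
have k_gt0 : 0 < 2 ^+ k :> R by rewrite exprn_gt0.
have sumE : 2 ^+ k * Pr P [set x | L x == v] =
    \sum_(c : 'cV['F_2]_k) chi (- (v *m c) 0 0) *
       \sum_x P x * chi ((L x *m c) 0 0).
  under [RHS]eq_bigr do rewrite mulr_sumr.
  rewrite exchange_big /Pr big_mkcond mulr_sumr; apply: eq_bigr => x _ /=.
  rewrite inE.
  transitivity (P x * \sum_(c : 'cV['F_2]_k) chi (((L x - v) *m c) 0 0)).
    rewrite sum_chi subr_eq0; case: eqP => _; first by rewrite mul1r mulrC.
    by rewrite mul0r !mulr0.
  rewrite mulr_sumr; apply: eq_bigr => c _.
  by rewrite mulmxBl mxE [in X in chi (_ + X)]mxE addrC chiD mulrCA.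
rewrite -(ler_pM2l k_gt0) sumE (bigD1 0) //= mulrDr mulfV ?gt_eqF //.
apply: lerD.
  under eq_bigr do rewrite mulmx0 mxE /chi eqxx expr0 mulr1.
  by rewrite P1 mulmx0 mxE oppr0 /chi eqxx expr0 mulr1.
apply: le_trans (ler_norm _) _; apply: le_trans (ler_norm_sum _ _ _) _.
apply: (@le_trans _ _ (\sum_(c : 'cV['F_2]_k) (2 * eps))).
  rewrite [leRHS](bigID (fun c => c != 0)) /= -[leLHS]addr0; apply: lerD.
    apply: ler_sum => c c_neq0; rewrite normrM norm_chi mul1r.
    apply: biased_character; [exact: biasP | | exact: Lnd].
    by move=> x y; rewrite LD mulmxDl mxE.
  by apply: sumr_ge0 => _ _; rewrite mulr_ge0.
by rewrite sumr_const card_mx card_Fp // muln1 -[leLHS]mulr_natl natrX.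
Qed.

(** * Union bound and the number of vectors of small weight *)

Lemma Pr_union {R : realType} {T I : finType} {P : T -> R} (E : {set T})
    (Q : pred I) (F : I -> {set T}) :
  (forall x, 0 <= P x) ->
  (forall x, x \in E -> exists2 i, Q i & x \in F i) ->
  Pr P E <= \sum_(i | Q i) Pr P (F i).
Proof.
move=> P_ge0 EF; rewrite /Pr.
under [leRHS]eq_bigr do rewrite big_mkcond.
rewrite exchange_big big_mkcond; apply: ler_sum => x _.
have sum_ge0 (J : pred I) : 0 <= \sum_(i | J i) (if x \in F i then P x else 0).
  by apply: sumr_ge0 => i _; case: ifP.
case: ifPn => // /EF[i Qi xFi].
by rewrite (bigD1 i) //= xFi lerDl.
Qed.

Lemma Pr_ge0 {R : realType} {T : finType} {P : T -> R} (E : {set T}) :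
  (forall x, 0 <= P x) -> 0 <= Pr P E.
Proof. by move=> P_ge0; apply: sumr_ge0. Qed.

Definition light (a m : nat) : {set 'rV['F_2]_m} :=
  [set v | (hamming_weight v <= a)%N].

(* Chernoff's argument: each vector of weight at most [a] contributes at least
   [t ^+ a] to the weight enumerator [(1 + t) ^+ m]. *)
Lemma card_light {R : realType} (t : R) (a m : nat) : 0 < t <= 1 ->
  #|light a m|%:R <= (1 + t) ^+ m / t ^+ a.
Proof.
move=> /andP[t_gt0 t_le1]; rewrite ler_pdivlMr ?exprn_gt0 // mulr_natl.
pose supp (v : 'rV['F_2]_m) := [set j | v 0 j != 0].
(* Over F_2 a vector is determined by its support, so light vectors can be counted as subsets. *)
have supp_inj : injective supp.
  move=> u v /setP uv; apply/rowP=> j; have := uv j; rewrite !inE.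
  by case: (F2_cases (u 0 j)) (F2_cases (v 0 j)) => -> [] ->.
have -> : (1 + t) ^+ m = \sum_(J : {set 'I_m}) t ^+ #|J|.
  transitivity (\prod_(i < m) (t + 1)).
    by rewrite prodr_const card_ord addrC.
  rewrite bigA_distr /=; apply: eq_bigr => J _.
  by rewrite -big_mkcond prodr_const.
rewrite -(card_imset _ supp_inj) -sumr_const [leRHS](bigID (mem (supp @: light a m))) /=.
rewrite -[leLHS]addr0; apply: lerD; last first.
  by apply: sumr_ge0 => J _; rewrite exprn_ge0 // ltW.
apply: ler_sum => _ /imsetP[v + ->]; rewrite inE => wt_v.
by apply: ler_wiXn2l => //; exact: ltW.
Qed.

(** * Linear images of a biased random matrix *)

Lemma bilinear_nondegenerate {n m : nat} {p : 'rV['F_2]_n} {q : 'cV['F_2]_m} :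
  p != 0 -> q != 0 ->
  exists x : 'rV['F_2]_(n * m), (p *m vec_mx x *m q) 0 0 != 0.
Proof.
move=> /matrix_neq0P[i0 [i pi]] /matrix_neq0P[j [j0 qj]].
(* An elementary matrix at a position with p_i = q_j = 1 gives the form the value 1. *)
exists (mxvec (delta_mx i j)); rewrite mxvecK.
have -> : delta_mx i j = delta_mx i (0 : 'I_1) *m delta_mx 0 j :> 'M['F_2]_(n, m).
  by rewrite mul_delta_mx.
rewrite mulmxA -colE -mulmxA -rowE mxE big_ord1 !mxE.
by rewrite (ord1 i0) in pi; rewrite (ord1 j0) in qj; rewrite pi qj.
Qed.

Lemma biased_row_combination {R : realType} {n m : nat} {eps : R}
    {P : 'rV['F_2]_(n * m) -> R} (u : 'rV['F_2]_n) (v : 'rV['F_2]_m) :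
  0 <= eps -> biased_sample_space eps P -> u != 0 ->
  Pr P [set x | u *m vec_mx x == v] <= 2 ^- m + 2 * eps.
Proof.
move=> eps_ge0 biasP u_neq0.
apply: (@biased_point _ _ _ _ _ (fun x => u *m vec_mx x)) => //.
  by move=> x y /=; rewrite linearD mulmxDr.
by move=> c c_neq0; exact: bilinear_nondegenerate.
Qed.

Lemma biased_col_combination {R : realType} {n m k : nat} {eps : R}
    {P : 'rV['F_2]_(n * m) -> R} (f : 'I_k -> 'I_n) (w : 'rV['F_2]_m) :
  injective f -> 0 <= eps -> biased_sample_space eps P -> w != 0 ->
  Pr P [set x | rowsub f (vec_mx x) *m w^T == 0] <= 2 ^- k + 2 * eps.
Proof.
move=> f_inj eps_ge0 biasP w_neq0.
pose L x := (rowsub f (vec_mx x : 'M_(n, m)) *m w^T)^T.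
have -> : [set x | rowsub f (vec_mx x) *m w^T == 0] = [set x | L x == 0].
  by apply/setP=> x; rewrite !inE /L -(inj_eq (@trmx_inj _ _ _)) trmx0.
apply: (biased_point L) => // [x y | c c_neq0].
  by rewrite /L !linearD /= mulmxDl linearD.
(* [p] carries the entries of [c] to the rows chosen by [f] and is 0 elsewhere, so testing the image
   against [c] becomes the bilinear form of [p] and [w]. *)
pose p : 'rV['F_2]_n := c^T *m rowsub f 1%:M.
have p_neq0 : p != 0.
  apply: contraNneq c_neq0 => p0; apply/eqP/colP=> i.
  have /rowP/(_ (f i)) := p0; rewrite !mxE => <-.
  rewrite (bigD1 i) //= !mxE eqxx mulr1 big1 ?addr0 // => j ji.
  by rewrite !mxE (inj_eq f_inj) (negPf ji) mulr0.
have wT_neq0 : w^T != 0 by rewrite trmx_eq0.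
have [x px] := bilinear_nondegenerate p_neq0 wT_neq0.
exists x; move: px; rewrite /L /p.
have -> : (rowsub f (vec_mx x) *m w^T)^T *m c =
    (c^T *m rowsub f 1%:M *m vec_mx x *m w^T)^T.
  by rewrite -(mulmxA c^T) [in RHS]mul_rowsub_mx mul1mx -mulmxA [RHS]trmx_mul trmxK.
by rewrite [in X in _ -> X]mxE.
Qed.

(** * Reduction of the desired properties to conditions on single vectors *)

Lemma good_code_gen_of_weight {R : realType} (delta : R) {n m : nat}
    (A : 'M['F_2]_(n, m)) :
  0 < delta * m%:R ->
  (forall u, u != 0 -> delta * m%:R <= (hamming_weight (u *m A))%:R) ->
  good_code_gen delta A.
Proof.
move=> dm_gt0 wtA; apply/andP; split.
  (* A nonzero [u] with [u *m A = 0] would give weight 0, below the positive bound. *)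
  apply: inj_row_free => u uA0; apply/eqP; apply: contraTT isT => u_neq0.
  have := wtA u u_neq0; rewrite uA0 /hamming_weight.
  rewrite (_ : [set j | _] = set0) ?cards0 ?leNgt ?dm_gt0 //.
  by apply/setP=> j; rewrite !inE mxE eqxx.
apply/forallP=> u; apply/implyP=> uA_neq0; apply: wtA.
by apply: contraNneq uA_neq0 => ->; rewrite mul0mx.
Qed.

(** A dependency [v] among the columns in [J], padded with zeros outside [J], is a vector [w] of
    weight at most [#|J|] killed by the rows in [I]. *)
Lemma submatrix_full_col_rank {n m : nat} (I : {set 'I_n}) (J : {set 'I_m})
    (A : 'M['F_2]_(n, m)) :
  (forall w : 'rV_m, w != 0 -> (hamming_weight w <= #|J|)%N ->
     rowsub (@enum_val _ (mem I)) A *m w^T != 0) ->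
  \rank (submatrix I J A) = #|J|.
Proof.
move=> Aw; rewrite -mxrank_tr; apply/eqP; apply: inj_row_free => v vA0.
pose g := @enum_val _ (mem J).
pose w : 'rV['F_2]_m := v *m (colsub g 1%:M)^T.
have wE j : w 0 (g j) = v 0 j.
  rewrite mxE (bigD1 j) //= !mxE eqxx mulr1 big1 ?addr0 // => k kj.
  by rewrite !mxE (inj_eq enum_val_inj) eq_sym (negPf kj) mulr0.
apply/eqP; apply: contraTT isT => v_neq0.
have w_neq0 : w != 0.
  apply: contraNneq v_neq0 => w0; apply/eqP/rowP=> j.
  by rewrite -wE w0 !mxE.
have wt_w : (hamming_weight w <= #|J|)%N.
  apply/subset_leq_card/subsetP=> j; rewrite inE; apply: contraNT => jJ.
  rewrite mxE big1 // => k _; rewrite !mxE; case: eqP => [jk|]; rewrite ?mulr0 //.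
  by rewrite jk enum_valP in jJ.
move: (Aw w w_neq0 wt_w); rewrite trmx_mul trmxK mulmxA mulmx_colsub mulmx1.
rewrite -(inj_eq (@trmx_inj _ _ _)) trmx_mul trmxK trmx0.
have <- : submatrix I J A = colsub g (rowsub (@enum_val _ (mem I)) A).
  by apply/matrixP=> i j; rewrite !mxE.
by rewrite vA0 eqxx.
Qed.

Lemma card_last_half_rows (n : nat) : #|last_half_rows n| = n./2.
Proof.
rewrite -[RHS]card_ord.
have lt_n (i : 'I_n./2) : (n - n./2 + i < n)%N by case: i => i /=; lia.
pose h i := Ordinal (lt_n i).
have h_inj : injective h by move=> i j /(congr1 val) /= ?; apply/val_inj => /=; lia.
rewrite -(card_imset _ h_inj); congr #|pred_of_set _|; apply/setP=> i.
rewrite inE; apply/idP/imsetP => [ni | [j _ ->]]; last exact: leq_addr.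
have lt_i : (i - (n - n./2) < n./2)%N by case: i ni => i /=; lia.
by exists (Ordinal lt_i) => //; apply/val_inj => /=; lia.
Qed.

(** * Elementary probability and the uniform distribution *)

Lemma Pr_union_card {R : realType} {T I : finType} {P : T -> R} (E : {set T})
    (A : {set I}) (F : I -> {set T}) (c : R) :
  (forall x, 0 <= P x) ->
  (forall x, x \in E -> exists2 i, i \in A & x \in F i) ->
  (forall i, i \in A -> Pr P (F i) <= c) ->
  Pr P E <= #|A|%:R * c.
Proof.
move=> P_ge0 EF Fc; apply: le_trans (Pr_union E (mem A) F P_ge0 EF) _.
by rewrite mulr_natl -sumr_const; exact: ler_sum.
Qed.

Lemma PrU {R : realType} {T : finType} {P : T -> R} (E F G : {set T}) :
  (forall x, 0 <= P x) -> E \subset F :|: G -> Pr P E <= Pr P F + Pr P G.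
Proof.
move=> P_ge0 /subsetP EFG.
have := @Pr_union R T bool P E predT (fun b => if b then F else G) P_ge0.
rewrite big_bool; apply=> x /EFG; rewrite inE.
by case/orP => ?; [exists true | exists false].
Qed.

Lemma PrC {R : realType} {T : finType} {P : T -> R} (E : {set T}) :
  \sum_x P x = 1 -> Pr P E = 1 - Pr P (~: E).
Proof.
move=> <-; rewrite /Pr [in RHS](bigID (mem E)) /=.
by under [X in _ - X]eq_bigl do rewrite inE; rewrite addrK.
Qed.

(** Flipping one coordinate of [S] preserves the uniform measure and exchanges the event with its
    complement, so the bias is exactly 0. *)
Lemma uniform_biased {R : realType} (eps : R) (N : nat) : 0 <= eps ->
  biased_sample_space eps
    (fun _ : 'rV['F_2]_N => #|{: 'rV['F_2]_N}|%:R^-1 : R).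
Proof.
move=> eps_ge0; set P := fun _ => _.
have P1 : \sum_x P x = 1.
  rewrite sumr_const -[LHS]mulr_natl mulfV // pnatr_eq0 -lt0n.
  by apply/card_gt0P; exists 0.
split=> [|S /set0Pn[i iS]]; first by split=> // x; rewrite invr_ge0 ler0n.
set E := [set x | _].
suff EC : Pr P E = Pr P (~: E).
  by have := PrC E P1; rewrite -EC => h; rewrite (_ : _ - _ = 0) ?normr0 //; lra.
rewrite /Pr (reindex_inj (addrI (delta_mx 0 i))); apply: eq_bigl => x.
rewrite !inE; under eq_bigr do rewrite mxE.
rewrite big_split /= (bigD1 i) //= mxE !eqxx big1 ?addr0; last first.
  by move=> j /andP[_ ji]; rewrite mxE (negPf ji).
by case: (F2_cases (\sum_(i in S) x 0 i)) => ->.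
Qed.

(** * Numerical estimates for the two union bounds *)

Lemma expr1D_le {R : realType} (t : R) (k : nat) : 0 <= t -> k%:R * t < 1 ->
  (1 + t) ^+ k <= (1 - k%:R * t)^-1.
Proof.
move=> t_ge0 kt_lt1; rewrite -[leRHS]mul1r ler_pdivlMr ?subr_gt0 //.
elim: k kt_lt1 => [|k IHk] kt_lt1; first by rewrite expr0 mul0r subr0 mulr1.
have kt : k%:R * t < 1 by apply: le_lt_trans kt_lt1; rewrite ler_wpM2r // ler_nat.
apply: le_trans (IHk kt); rewrite exprSr -mulrA ler_wpM2l //.
  by rewrite exprn_ge0 // addr_ge0.
have k_ge0 : 0 <= k%:R :> R by rewrite ler0n.
(* The gap between 1 - kt and (1 + t)(1 - (k + 1)t) is (k + 1)t^2. *)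
by rewrite -natr1; nra.
Qed.

Lemma light_row_tail {R : realType} (q : R) (n : nat) :
  0 < q -> q ^+ 8 = 2^-1 -> (0 < n)%N ->
  2 ^+ n * (#|light n (16 * n)|%:R * (3 * 2 ^- (16 * n))) <= 3 / 4 * q ^+ n.
Proof.
move=> q_gt0 q8 n_gt0.
have q_le1 : q <= 1.
  by rewrite -(@ler_pXn2r _ 8) ?nnegrE ?(ltW q_gt0) // q8 expr1n; lra.
have := @card_light R 4^-1 n (16 * n).
have t01 : 0 < (4^-1 : R) <= 1 by lra.
move=> /(_ t01) card_le.
apply: (@le_trans _ _ (2 ^+ n * ((1 + 4^-1) ^+ (16 * n) / 4^-1 ^+ n * (3 * 2 ^- (16 * n))))).
  apply: ler_wpM2l; first by rewrite exprn_ge0.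
  by apply: ler_wpM2r => //; rewrite mulr_ge0 // invr_ge0 exprn_ge0.
have -> : 2 ^+ n * ((1 + 4^-1) ^+ (16 * n) / 4^-1 ^+ n * (3 * 2 ^- (16 * n)))
    = 3 * (8 * (5 / 8) ^+ 16) ^+ n :> R.
  have -> : 8 * (5 / 8) ^+ 16 = 2 * ((1 + 4^-1) ^+ 16 / 4^-1 * 2 ^- 16) :> R.
    by field.
  rewrite !exprM [X in _ = 3 * X]exprMn [in RHS](exprMn n (_ / _)).
  by rewrite [in RHS](exprMn n _ 4^-1^-1) !exprVn [_ * (3 * _)]mulrCA [LHS]mulrCA.
(* Since (5/8)^4 <= 1/4, the left side is at most 8/256 = 1/32, while [q ^+ 24] is 1/8. *)
have r_le : 8 * (5 / 8) ^+ 16 <= q ^+ 24.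
  rewrite (exprM q 8 3) q8 (_ : 16 = 4 * 4)%N // exprM.
  have : (5 / 8) ^+ 4 <= 4^-1 :> R by lra.
  have : 0 <= (5 / 8) ^+ 4 :> R by rewrite exprn_ge0 //; lra.
  set y := _ ^+ 4 => y_ge0 y_le.
  have : y ^+ 4 <= 4^-1 ^+ 4 by rewrite lerXn2r ?nnegrE //; lra.
  by lra.
apply: (@le_trans _ _ (3 * (q ^+ 24) ^+ n)).
  rewrite ler_wpM2l // lerXn2r ?nnegrE ?exprn_ge0 ?(ltW q_gt0) //.
  by rewrite mulr_ge0 // exprn_ge0 //; lra.
(* One factor [q ^+ n] is kept; as n >= 1, the rest is at most [q ^+ 16] = 1/4, which turns the 3
   into 3/4. *)
have -> : (q ^+ 24) ^+ n = q ^+ n * q ^+ (23 * n) by rewrite -exprM -exprD; congr (_ ^+ _); lia.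
have : q ^+ (23 * n) <= q ^+ (8 * 2) by apply: ler_wiXn2l => //; [exact: ltW | lia].
rewrite [_ ^+ (8 * 2)]exprM q8 => le_q.
have : 0 < q ^+ n by rewrite exprn_gt0.
by nra.
Qed.

(** Everything is compared in powers of [q]: the light vectors number at most q^(-2n), whereas
    2^-(n/2) is about q^(4n). The spare factor q^n is the decay, and n >= 64 leaves room for a
    further q^32 to absorb constants. *)
Lemma light_col_tail {R : realType} (q : R) (n a : nat) :
  0 < q -> q ^+ 8 = 2^-1 -> (64 <= n)%N -> (64 * a <= n)%N ->
  #|light a (16 * n)|%:R * (3 * 2 ^- n./2) <= 4^-1 * q ^+ n.
Proof.
move=> q_gt0 q8 n_ge64 a_le.
have q_le1 : q <= 1.
  by rewrite -(@ler_pXn2r _ 8) ?nnegrE ?(ltW q_gt0) // q8 expr1n; lra.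
have qn_gt0 k : 0 < q ^+ k by rewrite exprn_gt0.
(* After raising to the 8th power this reads (1 + 1/256)^128 <= 2. *)
have base_le : (1 + 256^-1) ^+ 16 <= q^-1.
  rewrite -(@ler_pXn2r _ 8) ?nnegrE ?invr_ge0 ?exprn_ge0 ?(ltW q_gt0) //; last by lra.
  rewrite -exprM exprVn q8 invrK.
  have := @expr1D_le R 256^-1 (16 * 8).
  rewrite (_ : 1 - _ = 2^-1) ?invrK; last by lra.
  by apply; lra.
have card_le : #|light a (16 * n)|%:R <= q ^- n * q ^- n.
  apply: le_trans (@card_light R 256^-1 a (16 * n) _) _; first by lra.
  apply: ler_pM; rewrite ?invr_ge0 ?exprn_ge0 //; try lra.
    rewrite exprM -exprVn lerXn2r ?nnegrE ?invr_ge0 ?exprn_ge0 ?(ltW q_gt0) //; lra.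
  rewrite lef_pV2 ?posrE ?exprn_gt0 //; last by lra.
  have -> : 256^-1 = q ^+ 64 by rewrite (exprM q 8 8) q8; lra.
  by rewrite -exprM ler_wiXn2l // ltW.
(* With rounding, 8 * floor(n/2) >= 4n - 4 >= 3n + 32. *)
have half_le : 2 ^- n./2 <= q ^+ n * q ^+ n * q ^+ n * q ^+ 32.
  rewrite -exprVn -q8 -exprM -!exprD ler_wiXn2l ?(ltW q_gt0) //; lia.
apply: (@le_trans _ _ (q ^- n * q ^- n * (3 * (q ^+ n * q ^+ n * q ^+ n * q ^+ 32)))).
  apply: ler_pM => //; first by rewrite mulr_ge0 // invr_ge0 exprn_ge0.
  by rewrite ler_pM2l.
have -> : q ^- n * q ^- n * (3 * (q ^+ n * q ^+ n * q ^+ n * q ^+ 32)) = 3 * q ^+ 32 * q ^+ n.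
  by field; rewrite gt_eqF.
by rewrite ler_pM2r // (exprM q 8 4) q8; lra.
Qed.

(** * Probabilities of the two failure events *)

Lemma Pr_light_row {R : realType} {n m : nat} (a : nat) {eps : R}
    {P : 'rV['F_2]_(n * m) -> R} :
  0 <= eps -> biased_sample_space eps P ->
  Pr P [set x | [exists u : 'rV_n, (u != 0) && (u *m vec_mx x \in light a m)]]
    <= 2 ^+ n * (#|light a m|%:R * (2 ^- m + 2 * eps)).
Proof.
move=> eps_ge0 biasP; have [[P_ge0 _] _] := biasP.
have c_ge0 : 0 <= #|light a m|%:R * (2 ^- m + 2 * eps).
  by rewrite mulr_ge0 // addr_ge0 ?mulr_ge0 // invr_ge0 exprn_ge0.
apply: (@le_trans _ _ (#|[set u : 'rV['F_2]_n | u != 0]|%:R *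
    (#|light a m|%:R * (2 ^- m + 2 * eps)))).
  apply: (@Pr_union_card _ _ _ _ _ _
    (fun u => [set x | u *m vec_mx x \in light a m])) => //.
    move=> x; rewrite inE => /existsP[u /andP[u_neq0 ux]].
    by exists u; rewrite inE.
  move=> u; rewrite inE => u_neq0.
  (* A second union bound, for fixed [u], over the light values of [u *m vec_mx x]. *)
  apply: (@Pr_union_card _ _ _ _ _ _
    (fun v => [set x | u *m vec_mx x == v])) => //.
    by move=> x; rewrite inE => ux; exists (u *m vec_mx x); rewrite // inE.
  by move=> v _; exact: biased_row_combination.
apply: ler_wpM2r => //; rewrite -natrX ler_nat.
by apply: leq_trans (max_card _) _; rewrite card_mx card_Fp // mul1n.
Qed.

Lemma Pr_light_col {R : realType} {n m k : nat} (a : nat) {eps : R}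
    {P : 'rV['F_2]_(n * m) -> R} (f : 'I_k -> 'I_n) :
  injective f -> 0 <= eps -> biased_sample_space eps P ->
  Pr P [set x | [exists w : 'rV_m, (w \in light a m :\ 0) &&
                   (rowsub f (vec_mx x) *m w^T == 0)]]
    <= #|light a m :\ 0|%:R * (2 ^- k + 2 * eps).
Proof.
move=> f_inj eps_ge0 biasP; have [[P_ge0 _] _] := biasP.
apply: (@Pr_union_card _ _ _ _ _ _
  (fun w : 'rV_m => [set x | rowsub f (vec_mx x) *m w^T == 0])) => //.
  by move=> x; rewrite inE => /existsP[w /andP[w_light xw]]; exists w; rewrite // inE.
by move=> w; rewrite 2!inE => /andP[w_neq0 _]; exact: biased_col_combination.
Qed.

Lemma light0 (m : nat) : light 0 m = [set 0].
Proof.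
apply/setP=> v; rewrite !inE leqn0 cards_eq0; apply/eqP/eqP => [v0 | ->].
  apply/rowP=> j; have /setP/(_ j) := v0.
  by rewrite !inE mxE => /negbFE/eqP.
by apply/setP=> j; rewrite !inE mxE eqxx.
Qed.

Lemma desired_probability {R : realType} (q : R) (n : nat)
    (P : 'rV['F_2]_(n * (16 * n)) -> R) :
  0 < q -> q ^+ 8 = 2^-1 -> (0 < n)%N ->
  biased_sample_space (2 ^- (16 * n)) P ->
  1 - q ^+ n <=
    Pr P [set x | desired_matrix (64^-1 : R) (16^-1 : R)
                    (vec_mx x : 'M_(n, 16 * n))].
Proof.
move=> q_gt0 q8 n_gt0 biasP; have [[P_ge0 P1] _] := biasP.
set m := (16 * n)%N in P biasP P_ge0 P1 *; set eps := 2 ^- m in biasP.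
have eps_ge0 : 0 <= eps by rewrite invr_ge0 exprn_ge0.
set a := Num.truncn (64^-1 * n%:R : R).
have a_le : (64 * a <= n)%N.
  have : a%:R <= 64^-1 * n%:R :> R by rewrite truncn_le mulr_ge0 ?invr_ge0.
  by rewrite -(@ler_nat R) natrM => ?; lra.
set f := @enum_val _ (mem (last_half_rows n)).
have f_inj : injective f := enum_val_inj.
rewrite PrC // lerD2l lerN2.
set E1 := [set x : 'rV_(n * m) | [exists u : 'rV_n, (u != 0) &&
   (u *m vec_mx x \in light n m)]].
set E2 := [set x : 'rV_(n * m) | [exists w : 'rV_m, (w \in light a m :\ 0) &&
   (rowsub f (vec_mx x) *m w^T == 0)]].
(* Outside [E1] the code has large distance; outside [E2] the column ranks are full. The two failure
   probabilities receive the shares 3/4 and 1/4 of [q ^+ n]. *)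
apply: le_trans (PrU _ E1 E2 P_ge0 _) _.
  apply/subsetP=> x; apply: contraLR; rewrite !inE negbK negb_or !negb_exists.
  move=> /andP[/forallP xE1 /forallP xE2].
  apply/andP; split.
    have dm : 16^-1 * m%:R = n%:R :> R by rewrite natrM; field.
    apply: good_code_gen_of_weight; rewrite dm ?ltr0n // => u u_neq0.
    by have := xE1 u; rewrite u_neq0 inE /= -ltnNge ler_nat => /ltnW.
  apply/forallP=> J; apply/implyP=> /eqP cardJ; apply/eqP.
  apply: submatrix_full_col_rank => w w_neq0 wt_w.
  by have := xE2 w; rewrite !inE w_neq0 -[a]cardJ wt_w.
have E1_le : Pr P E1 <= 3 / 4 * q ^+ n.
  apply: le_trans (Pr_light_row n eps_ge0 biasP) _.
  have -> : 2 ^- m + 2 * eps = 3 * 2 ^- m by rewrite /eps; ring.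
  exact: light_row_tail.
have E2_le : Pr P E2 <= 4^-1 * q ^+ n.
  apply: le_trans (Pr_light_col a f f_inj eps_ge0 biasP) _.
  (* For [a = 0] the only light vector is 0, which is excluded, so [E2] has probability 0; [a > 0]
     forces n >= 64, as [light_col_tail] requires. *)
  have [a0|a_gt0] := posnP a.
    rewrite a0 light0 setDv cards0 mul0r.
    by rewrite mulr_ge0 ?invr_ge0 ?exprn_ge0 ?(ltW q_gt0).
  apply: le_trans (light_col_tail q n a q_gt0 q8 _ a_le); last by lia.
  apply: ler_pM => //; rewrite ?addr_ge0 ?mulr_ge0 ?invr_ge0 ?exprn_ge0 //.
    by rewrite ler_nat subset_leq_card // subD1set.
  rewrite card_last_half_rows.
  have : eps <= 2 ^- n./2.
    rewrite /eps -!exprVn ler_wiXn2l ?invr_ge0 //; first by lra.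
    by rewrite /m; lia.
  by lra.
by lra.
Qed.

(** * Choice of constants, existence and probability *)

Theorem theorem7p17 (R : realType) :
  exists (alpha beta delta : R) (m : nat -> nat),
    [/\ 0 < alpha < 1, 0 < beta < 1, 0 < delta,
        forall n : nat, (m n)%:R = n%:R / beta &
        (forall n : nat, exists A : 'M['F_2]_(n, m n),
           desired_matrix alpha delta A)
        /\
        (exists f g : nat -> R,
           [/\ O_linear f, Omega_linear g &
             forall (n : nat) (P : 'rV['F_2]_(n * m n) -> R),
               biased_sample_space (2 `^ (- f n)) P ->
               1 - 2 `^ (- g n) <=
                 Pr P [set x | desired_matrix alpha delta
                                 (vec_mx x : 'M['F_2]_(n, m n))]])].
Proof.
(* The failure bound is 2^(-n/8), written as the natural power [q ^+ n]. *)
pose q : R := 2 `^ (- 8^-1).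
have q_gt0 : 0 < q by rewrite powR_gt0.
have qX n : 2 `^ (- (n%:R / 8)) = q ^+ n.
  by rewrite -powR_mulrn ?(ltW q_gt0) // -powRrM mulNr [_ / _]mulrC.
have q8 : q ^+ 8 = 2^-1.
  by rewrite -qX divff ?powRN ?powRr1 // pnatr_eq0.
have q_lt1 : q < 1.
  by rewrite -(@ltr_pXn2r _ 8) ?nnegrE ?(ltW q_gt0) // q8 expr1n; lra.
exists 64^-1, 16^-1, 16^-1, (fun n => 16 * n)%N.
split; [lra | lra | lra | by move=> n; rewrite natrM invrK mulrC | split].
  (* For [n = 0] the probability bound is only 0, so the empty matrix is checked directly. *)
  case=> [|n].
    exists 0; apply/andP; split.
      apply/andP; split; first by rewrite /row_free mxrank0.
      by apply/forallP=> u; rewrite mulmx0 eqxx.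
    apply/forallP=> J; apply/implyP; rewrite mulr0 truncn0 => /eqP cardJ.
    by rewrite eqn_leq rank_leq_col; apply: (@leq_trans 0); rewrite ?cardJ.
  have eps_ge0 : 0 <= 2 ^- (16 * n.+1) :> R by rewrite invr_ge0 exprn_ge0.
  have := desired_probability q n.+1 _ q_gt0 q8 isT (uniform_biased _ _ eps_ge0).
  set E := [set x | _] => le_PrE.
  (* The event has positive probability because q^(n+1) < 1. *)
  have /set0Pn[x] : E != set0.
    apply: contraTneq le_PrE => ->.
    by rewrite /Pr big_set0 -ltNge subr_gt0 exprn_ilt1 ?(ltW q_gt0).
  by rewrite inE => ?; exists (vec_mx x).
exists (fun n => 16 * n%:R), (fun n => n%:R / 8); split.
- by exists 16 => n; rewrite mulr_ge0 ?lexx.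
- by exists 8^-1 => [|n]; [lra | rewrite mulrC].
move=> n P; rewrite qX powRN -natrM powR_mulrn // => biasP.
have [n0|n_gt0] := posnP n; last exact: desired_probability.
have [[P_ge0 _] _] := biasP.
by rewrite {1}n0 expr0 subrr Pr_ge0.
Qed.
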